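(* There is an absolute constant $C$ such that every string graph $G$ with $n \ge 2$ vertices admits a $3$-hop spanner with at most $C\, n\log^3 n$ edges.
   Context: A string graph is the intersection graph of a finite collection of curves (strings) in the plane: the vertices are the curves, and two vertices are adjacent iff the curves intersect. For an unweighted undirected graph $G$ and an integer $t\ge 1$, a $t$-hop spanner of $G$ is a subgraph $\widehat{G}$ of $G$ (on the same vertex set) such that for every edge $uv\in E(G)$ there is a path from $u$ to $v$ in $\widehat{G}$ with at most $t$ edges. The size of a spanner is its number of edges. *)

(* Defs.v *)
From mathcomp Require Import all_boot.
From Stdlib Require Import Reals.

Set Implicit Arguments.
Unset Strict Implicit.
Unset Printing Implicit Defensive.

(* A simple undirected graph on a finite vertex type V is a symmetric,
   irreflexive boolean relation e : rel V. *)

(* A string graph: there are curves (continuous maps [0,1] -> R^2; we take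
   continuous maps R -> R^2 restricted to [0,1], which is equivalent since any
   continuous path on [0,1] extends continuously to R) such that distinct
   vertices are adjacent iff their curves intersect. *)
Definition is_string_graph (V : finType) (e : rel V) : Prop :=
  exists g : V -> R -> (R * R)%type,
    (forall v, continuity (fun t => fst (g v t)) /\
               continuity (fun t => snd (g v t))) /\
    (forall u v, u <> v ->
       (e u v <-> exists s t : R,
           (0 <= s <= 1)%R /\ (0 <= t <= 1)%R /\ g u s = g v t)).

Definition hop_spanner (V : finType) (t : nat) (e H : rel V) : Prop :=
  symmetric H /\ subrel H e /\
  forall u v, e u v ->
    exists p : seq V, [&& path H u p, last u p == v & size p <= t].

Definition num_edges (V : finType) (H : rel V) : nat :=
  #|[set p : V * V | H p.1 p.2]| %/ 2.

(* Main.v *)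
(* Rasterizing the curves on a fine square grid turns G into the intersection
   graph of connected sets of cells.  Let B induce a connected subgraph, with BFS
   levels from a root, and give each cell x a lattice path to a base cell that
   only meets curves in the closed neighbourhood N[R_x] of a set R_x having at
   most one vertex per level (a shortest path of G).  If for every unit square
   removing N[R_x] for its four corners x left a component with more than half
   of B, then the parity of the closed walk through an edge xy around that large
   component would be a function of the edge that sums to zero around each square
   but to one around the boundary of a big box.  So some R with at most four
   vertices per level has N[R] as a balanced separator.  Cluster N[R] into stars
   centred in R.  A vertex sees at most 20 clusters, as the levels of their
   centres are within 2 of its own, and one edge to each cluster it sees plus the
   star edges give 3-hop paths u - s - centre - v.  Recursing on B minus N[R]
   gives O(n log n) edges. *)

From Stdlib Require Import Reals Lra ClassicalEpsilon.
From Coquelicot Require Import Rcomplements Compactness.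
Require Import Defs.
From mathcomp Require Import all_boot zify.

Set Implicit Arguments.
Unset Strict Implicit.
Unset Printing Implicit Defensive.

(* Importing MathComp last rebinds the key [R]. *)
Delimit Scope R_scope with R.
Local Open Scope nat_scope.

(** * Crossing parities on the square grid *)

Definition cell := (nat * nat)%type.

Definition cell_adj (a b : cell) : bool :=
  (a.1 == b.1) && ((a.2.+1 == b.2) || (b.2.+1 == a.2)) ||
  (a.2 == b.2) && ((a.1.+1 == b.1) || (b.1.+1 == a.1)).

(* The lattice edge [xy] crosses the upward vertical ray that starts at [z],
   shifted right by half a unit. *)
Definition crosses (z x y : cell) : bool :=
  (x.2 == y.2) && (z.2 < x.2) &&
  ((x.1 == z.1) && (y.1 == z.1.+1) || (y.1 == z.1) && (x.1 == z.1.+1)).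

(* The cells whose indicator function has coboundary [crosses z + crosses z'],
   see [crosses_shift]. *)
Definition right_ray (z z' a : cell) : bool :=
  (z.2 == z'.2) && (a.1 == maxn z.1 z'.1) && (z.2 < a.2).

Lemma cell_adj_sym a b : cell_adj a b = cell_adj b a.
Proof.
by rewrite /cell_adj eq_sym (eq_sym a.2 b.2) orbC (orbC (a.1.+1 == _)) orbC
  (orbC (a.2.+1 == _)).
Qed.

Lemma crosses_sym z x y : crosses z x y = crosses z y x.
Proof.
by rewrite /crosses eq_sym orbC; case: eqP => [->|].
Qed.

Lemma crosses_horizontal z i j :
  crosses z (i, j) (i.+1, j) = (z.2 < j) && (i == z.1).
Proof. by rewrite /crosses /= eqxx eqSS; case: (z.2 < j) => //=; lia. Qed.

Lemma crosses_vertical z i j : crosses z (i, j) (i, j.+1) = false.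
Proof. by rewrite /crosses /= ltn_eqF. Qed.

(** A vertical move only affects a horizontal edge that ends in [z] or [z']. After a horizontal move
    the two rays border the column [right_ray], whose only outgoing vertical edge ends in the
    excluded cell at its foot. *)
Lemma crosses_shift z z' x y :
  cell_adj z z' -> cell_adj x y ->
  x != z -> x != z' -> y != z -> y != z' ->
  crosses z x y (+) crosses z' x y = right_ray z z' x (+) right_ray z z' y.
Proof.
wlog: x y / (y == (x.1, x.2.+1)) || (y == (x.1.+1, x.2)).
  move=> W zz' xy *.
  case: (boolP ((y == (x.1, x.2.+1)) || (y == (x.1.+1, x.2)))) => [|hy].
    by move/W; apply.
  rewrite addbC ![crosses _ x y]crosses_sym addbC [RHS]addbC.
  apply: W => //; last by rewrite cell_adj_sym.
  clear -hy xy; case: x y hy xy => [x1 x2] [y1 y2].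
  by rewrite /cell_adj /= !xpair_eqE; lia.
case: z z' x => [z1 z2] [w1 w2] [x1 x2].
by rewrite /cell_adj /= => /orP[] /eqP->; rewrite ?crosses_horizontal
  ?crosses_vertical /right_ray /= !xpair_eqE;
  case/orP=> [/andP[/eqP<- /orP[] /eqP<-]|/andP[/eqP<- /orP[] /eqP<-]];
  lia.
Qed.

(** The ray above [z] meets both horizontal sides of the square or neither, unless it starts at the
    lower one. *)
Lemma square_crossings z i j :
  z != (i, j) ->
  crosses z (i, j) (i.+1, j) (+) crosses z (i, j.+1) (i.+1, j.+1)
  (+) (crosses z (i, j) (i, j.+1) (+) crosses z (i.+1, j) (i.+1, j.+1)) = false.
Proof.
case: z => [z1 z2]; rewrite !crosses_horizontal !crosses_vertical !xpair_eqE /=.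
lia.
Qed.

(** * Connectedness and breadth-first levels *)

Definition grid_connected (A : cell -> Prop) : Prop :=
  forall Q : cell -> Prop, (exists2 x, A x & Q x) ->
  (forall x y, A x -> A y -> cell_adj x y -> Q x -> Q y) ->
  forall x, A x -> Q x.

(** Like [grid_connected], an induction principle, applied directly with parities in the predicate.
    The empty set counts as connected. *)
Definition set_connected (V : finType) (e : rel V) (D : {set V}) : Prop :=
  forall Q : V -> Prop, (exists2 u, u \in D & Q u) ->
  (forall u v, u \in D -> v \in D -> e u v -> Q u -> Q v) ->
  forall v, v \in D -> Q v.

Definition closed_nbhd (V : finType) (e : rel V) (R : {set V}) : {set V} :=
  [set w | (w \in R) || [exists p in R, e p w]].

Lemma fun_choice (A B : Type) (P : A -> B -> Prop) :
  (forall x, exists y, P x y) -> exists f, forall x, P x (f x).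
Proof.
move=> h; exists (fun x => sval (constructive_indefinite_description _ (h x))).
by move=> x; apply: svalP.
Qed.

Lemma sub_closed_nbhd (V : finType) (e : rel V) (R R' : {set V}) :
  R \subset R' -> closed_nbhd e R \subset closed_nbhd e R'.
Proof.
move=> /subsetP sRR'; apply/subsetP=> w; rewrite !inE.
case/orP=> [/sRR'->//|/existsP[p /andP[/sRR' pR' epw]]].
by apply/orP; right; apply/existsP; exists p; rewrite pR'.
Qed.

Lemma bfs_levels (V : finType) (e : rel V) (B : {set V}) (r : V) :
  set_connected e B -> r \in B ->
  exists d : V -> nat,
    (forall v, v \in B -> v != r ->
       exists2 u, u \in B & e u v /\ d v = (d u).+1) /\
    {in B &, forall u v, e u v -> d v <= (d u).+1}.
Proof.
move=> Bconn rB.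
pose step (A : {set V}) := A :|: [set v in B | [exists u in A, e u v]].
(* The level of [v] is the least [k] with [v] in [ball k]; a vertex new in [ball k.+1] has its
   parent in [ball k]. *)
pose ball k := iter k step [set r].
have stepP k u v : u \in ball k -> v \in B -> e u v -> v \in ball k.+1.
  move=> uk vB euv; rewrite /= !inE vB /=; apply/orP; right.
  by apply/existsP; exists u; rewrite uk.
have ballB k v : v \in ball k -> v \in B.
  elim: k v => [|k IH] v; first by rewrite inE => /eqP->.
  by rewrite /= !inE => /orP[/IH//|/andP[]].
have /fun_choice[d dP] v : exists k, v \in B ->
    v \in ball k /\ forall k', v \in ball k' -> k <= k'.
  case: (boolP (v \in B)) => [vB|_]; last by exists 0.
  have ex : exists k, v \in ball k.
    apply: (Bconn (fun v => exists k, v \in ball k)) vB.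
      by exists r => //; exists 0; rewrite inE.
    by move=> u w _ wB euw [k uk]; exists k.+1; apply: stepP euw.
  by case: (ex_minnP ex) => k vk kmin; exists k.
have lip : {in B &, forall u v, e u v -> d v <= (d u).+1}.
  move=> u v uB vB euv; have [_ ] := dP v vB; apply.
  by have [ud _] := dP u uB; apply: stepP euv.
exists d; split=> // v vB vr.
have [] := dP v vB; case dv: (d v) => [|k]; first by rewrite inE (negPf vr).
rewrite /= !inE vB /= => /orP[vk /(_ k vk)|]; first by rewrite ltnn.
case/existsP=> u /andP[uk euv] _.
have uB := ballB _ _ uk; exists u => //; split=> //; congr _.+1.
apply/eqP; rewrite eqn_leq -ltnS -dv lip //=.
by have [_] := dP u uB; apply.
Qed.

Lemma xor_telescope (n : nat) (h : nat -> bool) :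
  \big[addb/false]_(i < n) (h i (+) h i.+1) = h 0 (+) h n.
Proof.
elim: n => [|n IH]; first by rewrite big_ord0 addbb.
by rewrite big_ord_recr /= IH; case: (h 0); case: (h n); case: (h n.+1).
Qed.

(** * A balanced separator *)

Section GridSeparator.

Variables (V : finType) (e : rel V) (S : V -> cell -> Prop) (N : nat).
Hypothesis S_connected : forall v, grid_connected (S v).
Hypothesis S_nonempty : forall v, exists z, S v z.
Hypothesis S_box : forall v z, S v z -> 0 < z.1 < N /\ 0 < z.2 < N.
Hypothesis S_adjacent : forall u v, e u v -> exists2 z, S u z & S v z.
Hypothesis S_meet : forall u v z, S u z -> S v z -> u = v \/ e u v.

Variables (B : {set V}) (r : V) (b : cell) (d : V -> nat).
Hypothesis rB : r \in B.
Hypothesis rb : S r b.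
Hypothesis d_parent : forall v, v \in B -> v != r ->
  exists2 u, u \in B & e u v /\ d v = (d u).+1.

(** Walks avoid the cells of the surviving curves, so that the parity of a closed walk stays
    constant while the ray moves along these curves. *)
Let blocked (R : {set V}) (z : cell) : Prop :=
  exists2 w, w \in B :\: closed_nbhd e R & S w z.

(* Stands for a lattice path from [x] to [b] avoiding the blocked cells: [pi z]
   is the parity of its crossings with the ray above [z], and only the rule for
   changing [z] is kept. *)
Let reachable (R : {set V}) (x : cell) (pi : cell -> bool) : Prop :=
  ~ blocked R x /\
  forall z z', blocked R z -> blocked R z' -> cell_adj z z' ->
    pi z (+) pi z' = right_ray z z' x (+) right_ray z z' b.

Let thin (R : {set V}) : Prop :=
  R \subset B /\ {in R &, injective d}.

Lemma blocked_sub (R R' : {set V}) z :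
  R \subset R' -> blocked R' z -> blocked R z.
Proof.
move=> sRR' [w wR' Swz]; exists w => //.
by apply: subsetP wR'; apply: setDS; apply: sub_closed_nbhd.
Qed.

Lemma blocked_neq R x z : ~ blocked R x -> blocked R z -> x != z.
Proof. by move=> nx bz; apply/eqP => xz; apply: nx; rewrite xz. Qed.

(** Prepends the edge [xy] to the walk. Both ends are unblocked, hence differ from [z] and [z'] as
    [crosses_shift] demands. *)
Lemma reachable_step R x y pi :
  ~ blocked R x -> cell_adj x y -> reachable R y pi ->
  reachable R x (fun z => crosses z x y (+) pi z).
Proof.
move=> nx xy [ny pi_y]; split=> // z z' bz bz' zz'.
have neq := blocked_neq nx; have neq' := blocked_neq ny.
have := crosses_shift zz' xy (neq _ bz) (neq _ bz') (neq' _ bz) (neq' _ bz').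
have := pi_y z z' bz bz' zz'.
case: (pi z) (pi z') (crosses z x y) (crosses z' x y) => [] [] [] [];
  case: (right_ray z z' x); case: (right_ray z z' y);
  by case: (right_ray z z' b).
Qed.

Lemma reachable_sub (R R' : {set V}) x pi :
  R \subset R' -> reachable R x pi -> reachable R' x pi.
Proof.
move=> sRR' [nx pi_x]; split; first by move/(blocked_sub sRR').
by move=> z z' /(blocked_sub sRR') bz /(blocked_sub sRR') bz'; apply: pi_x.
Qed.

Lemma not_blocked (R : {set V}) v z : v \in R -> S v z -> ~ blocked R z.
Proof.
move=> vR Svz [w]; rewrite !inE negb_or -andbA => /and3P[wR Rw _] Swz.
have [vw|evw] := S_meet Svz Swz; first by rewrite -vw vR in wR.
by move/negP: Rw; apply; apply/existsP; exists v; rewrite vR.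
Qed.

Lemma reachable_string (R : {set V}) v x y :
  v \in R -> S v x -> S v y -> (exists pi, reachable R x pi) ->
  exists pi, reachable R y pi.
Proof.
move=> vR Svx Svy hx.
apply: (S_connected (Q := fun y => exists pi, reachable R y pi)) Svy.
  by exists x.
move=> p q _ Svq pq [pi pi_p]; exists (fun z => crosses z q p (+) pi z).
by apply: reachable_step pi_p; [apply: not_blocked Svq|rewrite cell_adj_sym].
Qed.

(** [R] is the chain of parents from [v] to the root: follow the curve of [v] to a cell shared with
    its parent and continue by induction. The bound on levels keeps [d] injective when [v] is
    added. *)
Lemma string_cell_reachable v : v \in B ->
  exists R, [/\ thin R, v \in R, {in R, forall u, d u <= d v} &
    forall x, S v x -> exists pi, reachable R x pi].
Proof.
have [n] := ubnP (d v); elim: n v => // n IH v dvn vB.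
have [->|vr] := eqVneq v r.
  exists [set r]; split; rewrite ?inE //.
  - split; first by rewrite sub1set.
    by move=> u w; rewrite !inE => /eqP-> /eqP->.
  - by move=> u; rewrite inE => /eqP->.
  move=> x rx; apply: (reachable_string _ rb rx); rewrite ?inE //.
  exists (fun=> false); split=> [|z z' _ _ _]; last by rewrite !addbb.
  by apply: not_blocked rb; rewrite inE.
have [u uB [euv dv]] := d_parent vB vr.
have [|R [[RB Rinj] uR Rd Rreach]] := IH u _ uB; first by rewrite dv in dvn.
exists (v |: R); split; rewrite ?setU11 //.
- split; first by rewrite subUset sub1set vB.
  move=> p q /setU1P[->|pR] /setU1P[->|qR] //.
  + by move=> dpq; have := Rd q qR; rewrite -dpq dv ltnn.
  + by move=> dpq; have := Rd p pR; rewrite dpq dv ltnn.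
  + exact: Rinj.
- by move=> p /setU1P[->//|/Rd]; rewrite dv; apply: leqW.
move=> x Svx; have [y Suy Svy] := S_adjacent euv.
apply: (reachable_string (setU11 v R) Svy Svx).
by have [pi pi_y] := Rreach y Suy; exists pi; apply: reachable_sub pi_y; apply: subsetUr.
Qed.

Let free (x : cell) := ~ exists2 w, w \in B & S w x.

Lemma free_not_blocked R x : free x -> ~ blocked R x.
Proof. by move=> fx [w]; rewrite inE => /andP[_ wB] Swx; apply: fx; exists w. Qed.

(** Walk straight towards [b] through free cells, which no [R] blocks, up to the first cell on a
    curve of [B]. *)
Lemma cell_reachable x : exists R, thin R /\ exists pi, reachable R x pi.
Proof.
(* Truncated differences in both orders add up to the Manhattan distance. *)
pose dist (x : cell) := (x.1 - b.1) + (b.1 - x.1) + ((x.2 - b.2) + (b.2 - x.2)).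
have toward x' : x' != b -> exists2 y, cell_adj x' y & dist y < dist x'.
  rewrite {}/dist; case: x' b => [x1 x2] [b1 b2].
  rewrite xpair_eqE /cell_adj /=; case: (ltngtP x1 b1) => [lt1|gt1|->] /= neq.
  - by exists (x1.+1, x2) => /=; lia.
  - by exists (x1.-1, x2) => /=; lia.
  - case: (ltngtP x2 b2) neq => [lt2|gt2|//] _.
    + by exists (b1, x2.+1) => /=; lia.
    + by exists (b1, x2.-1) => /=; lia.
have [n] := ubnP (dist x); elim: n x => // n IH x xn.
case: (excluded_middle_informative (exists2 w, w \in B & S w x)) => [|fx].
  by case=> w wB Swx; have [R [? _ _ /(_ x Swx)]] := string_cell_reachable wB; exists R.
have xb : x != b by apply/eqP=> xb; apply: fx; rewrite xb; exists r.
have [y xy yx] := toward x xb; have yn := leq_trans yx xn.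
have [R [thinR [pi pi_y]]] := IH y yn.
exists R; split=> //; exists (fun z => crosses z x y (+) pi z).
by apply: reachable_step pi_y => //; apply: free_not_blocked.
Qed.

Definition on_boundary (x : cell) :=
  [&& x.1 <= N, x.2 <= N & [|| x.1 == 0, x.1 == N, x.2 == 0 | x.2 == N]].

Lemma on_boundary_free x : on_boundary x -> free x.
Proof.
move=> bx [w _ /S_box [/andP[x1 x1N] /andP[x2 x2N]]].
move: bx; rewrite /on_boundary (gtn_eqF x1) (ltn_eqF x1N) (gtn_eqF x2) (ltn_eqF x2N).
by rewrite !andbF.
Qed.

(** The boundary of the box meets no curve, so the walk from the corner extends along it with the
    same [R]. *)
Lemma boundary_reachable R x :
  (exists pi, reachable R (0, 0) pi) -> on_boundary x ->
  exists pi, reachable R x pi.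
Proof.
move=> h0.
have inward x' : x' != (0, 0) -> on_boundary x' ->
    exists y, [/\ cell_adj x' y, y.1 + y.2 < x'.1 + x'.2 & on_boundary y].
  case: x' => [x1 x2]; rewrite /on_boundary xpair_eqE /cell_adj /= => x0 bx'.
  case: (boolP (((x1 == 0) || (x1 == N)) && (0 < x2))) => h.
    by exists (x1, x2.-1) => /=; split; lia.
  by exists (x1.-1, x2) => /=; split; lia.
have [n] := ubnP (x.1 + x.2); elim: n x => // n IH x xn bx.
have [/eqP x0|x0] := boolP (x == (0, 0)); first by rewrite x0.
have [y [xy yx by_]] := inward x x0 bx; have yn := leq_trans yx xn.
have [pi pi_y] := IH y yn by_; exists (fun z => crosses z x y (+) pi z).
by apply: reachable_step pi_y => //; apply: free_not_blocked; apply: on_boundary_free.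
Qed.

(* Parity of the closed walk [b ~> x - y ~> b] around the cell [z]. *)
Let winding (pi : cell -> cell -> bool) (x y z : cell) : bool :=
  pi x z (+) crosses z x y (+) pi y z.

(** Both walks end in [b], so its terms cancel; [crosses_shift] on [xy] absorbs those at [x] and
    [y]. *)
Lemma winding_step R R' pi x y z z' :
  reachable R x (pi x) -> reachable R' y (pi y) -> cell_adj x y ->
  blocked R z -> blocked R z' -> blocked R' z -> blocked R' z' ->
  cell_adj z z' -> winding pi x y z = winding pi x y z'.
Proof.
move=> [nx pi_x] [ny pi_y] xy bz bz' cz cz' zz'; rewrite /winding.
have neq := blocked_neq nx; have neq' := blocked_neq ny.
have := crosses_shift zz' xy (neq _ bz) (neq _ bz') (neq' _ cz) (neq' _ cz').
have := pi_x z z' bz bz' zz'; have := pi_y z z' cz cz' zz'.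
case: (pi x z) (pi x z') (pi y z) (pi y z') => [] [] [] [];
  case: (crosses z x y); case: (crosses z' x y);
  case: (right_ray z z' x); case: (right_ray z z' y);
  by case: (right_ray z z' b).
Qed.

(** The cell moves along the curves of [D], changing curves at shared cells, and stays blocked for
    both [R] and [R']. *)
Lemma winding_connected R R' pi x y (D : {set V}) u v z z' :
  reachable R x (pi x) -> reachable R' y (pi y) -> cell_adj x y ->
  set_connected e D -> D \subset B :\: closed_nbhd e R ->
  D \subset B :\: closed_nbhd e R' ->
  u \in D -> v \in D -> S u z -> S v z' -> winding pi x y z = winding pi x y z'.
Proof.
move=> hx hy xy Dconn /subsetP DR /subsetP DR' uD vD Suz.
have inside w z1 z2 : w \in D -> S w z1 -> S w z2 ->
    winding pi x y z1 = winding pi x y z2.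
  move=> wD Sw1 Sw2.
  apply: (S_connected (Q := fun t => winding pi x y z1 = winding pi x y t)) Sw2.
    by exists z1.
  move=> p q Swp Swq pq ->; apply: winding_step hx hy xy _ _ _ _ pq;
    by exists w; auto.
apply: (Dconn (fun w => forall t, S w t -> winding pi x y z = winding pi x y t)) vD z'.
  by exists u => // t; apply: inside.
move=> w w' wD w'D /S_adjacent[t Swt Sw't] IH t' Sw't'.
by rewrite (IH t Swt); apply: inside Sw't'.
Qed.

Let large (D : {set V}) : Prop := set_connected e D /\ #|B| < 2 * #|D|.

Lemma large_meet (D D' : {set V}) : D \subset B -> D' \subset B -> large D -> large D' ->
  exists2 v, v \in D & v \in D'.
Proof.
move=> DB D'B [_ lD] [_ lD'].
have [D0|[v]] := set_0Vmem (D :&: D'); last by rewrite inE => /andP[]; exists v.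
have : #|D :|: D'| <= #|B| by apply: subset_leq_card; rewrite subUset DB.
by rewrite cardsU D0 cards0; lia.
Qed.

Lemma balanced_square : exists R : cell -> {set V},
  (forall x, thin (R x)) /\
  exists i j, forall D, set_connected e D ->
    D \subset B :\: closed_nbhd e
       (R (i, j) :|: R (i.+1, j) :|: (R (i, j.+1) :|: R (i.+1, j.+1))) ->
    2 * #|D| <= #|B|.
Proof.
have [R0 [thin0 reach0]] := cell_reachable (0, 0).
(* All boundary cells receive the same set [R0]. *)
have /fun_choice[R] x : exists R, [/\ thin R, exists pi, reachable R x pi &
    on_boundary x -> R = R0].
  case: (boolP (on_boundary x)) => [bx|_].
    by exists R0; split=> //; apply: boundary_reachable.
  by have [R [? ?]] := cell_reachable x; exists R.
move=> RP; have thinR x : thin (R x) by case: (RP x).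
have R_boundary x : on_boundary x -> R x = R0 by case: (RP x).
have /fun_choice[pi piP] x : exists pi, reachable (R x) x pi by case: (RP x).
exists R; split=> //.
case: (excluded_middle_informative (exists i j, forall D, set_connected e D ->
    D \subset B :\: closed_nbhd e
       (R (i, j) :|: R (i.+1, j) :|: (R (i, j.+1) :|: R (i.+1, j.+1))) ->
    2 * #|D| <= #|B|)) => // unbalanced; exfalso.
have big i j : exists D, large D /\ D \subset B :\: closed_nbhd e
    (R (i, j) :|: R (i.+1, j) :|: (R (i, j.+1) :|: R (i.+1, j.+1))).
  case: (excluded_middle_informative (exists D, large D /\ D \subset B :\: closed_nbhd e
    (R (i, j) :|: R (i.+1, j) :|: (R (i, j.+1) :|: R (i.+1, j.+1))))) => // no.
  case: unbalanced; exists i, j => D Dconn DR; rewrite leqNgt; apply/negP => lD.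
  by apply: no; exists D.
have sub (R1 R2 D : {set V}) : R1 \subset R2 -> D \subset B :\: closed_nbhd e R2 ->
    D \subset B :\: closed_nbhd e R1.
  by move=> s12 D2; apply: subset_trans D2 (setDS _ (sub_closed_nbhd e s12)).
have subB (R1 D : {set V}) : D \subset B :\: closed_nbhd e R1 -> D \subset B.
  by move=> DR; apply: subset_trans DR (subsetDl _ _).
have wit (D : {set V}) : large D -> exists w z, w \in D /\ S w z.
  case=> _ lD; have /card_gt0P[w wD] : 0 < #|D| by lia.
  by have [z Swz] := S_nonempty w; exists w, z.
(* [beta] is the winding parity around any large set surviving at both ends of the edge: two such
   sets meet, and the parity is constant on each. If there is none, the value is arbitrary. *)
have /fun_choice[beta betaP] (xy : cell * cell) : exists beta, cell_adj xy.1 xy.2 ->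
    forall D w z, large D -> D \subset B :\: closed_nbhd e (R xy.1) ->
    D \subset B :\: closed_nbhd e (R xy.2) -> w \in D -> S w z ->
    winding pi xy.1 xy.2 z = beta.
  case: xy => x y /=.
  case: (excluded_middle_informative (exists D, [/\ large D,
    D \subset B :\: closed_nbhd e (R x) & D \subset B :\: closed_nbhd e (R y)]))
    => [[D [lD Dx Dy]]|no]; last first.
    by exists true => _ D w z lD Dx Dy; case: no; exists D.
  have [w [z [wD Swz]]] := wit D lD.
  exists (winding pi x y z) => xy D' w' z' lD' D'x D'y w'D Sw'z'.
  have [v vD vD'] := large_meet (subB _ _ Dx) (subB _ _ D'x) lD lD'.
  have [t Svt] := S_nonempty v.
  rewrite (winding_connected (piP x) (piP y) xy (proj1 lD') D'x D'y w'D vD' Sw'z' Svt).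
  by rewrite (winding_connected (piP x) (piP y) xy (proj1 lD) Dx Dy wD vD Swz Svt).
pose h i j := beta ((i, j), (i.+1, j)).
pose v i j := beta ((i, j), (i, j.+1)).
have adj_h i j : cell_adj (i, j) (i.+1, j) by rewrite /cell_adj /= !eqxx orbT.
have adj_v i j : cell_adj (i, j) (i, j.+1) by rewrite /cell_adj /= !eqxx.
(* One large [D] survives at all four corners. Each [pi] term occurs in two sides and cancels, which
   leaves [square_crossings]. *)
have square i j : h i j (+) h i j.+1 (+) (v i j (+) v i.+1 j) = false.
  have [D [lD DR]] := big i j; have [w [z [wD Swz]]] := wit D lD.
  have D00 : D \subset B :\: closed_nbhd e (R (i, j)).
    by apply: sub DR; rewrite -setUA subsetUl.
  have D10 : D \subset B :\: closed_nbhd e (R (i.+1, j)).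
    by apply: sub DR; rewrite (setUC (R (i, j))) -setUA subsetUl.
  have D01 : D \subset B :\: closed_nbhd e (R (i, j.+1)).
    by apply: sub DR; rewrite setUCA subsetUl.
  have D11 : D \subset B :\: closed_nbhd e (R (i.+1, j.+1)).
    by apply: sub DR; rewrite !setUA subsetUr.
  rewrite /h /v.
  rewrite -(betaP (_, _) (adj_h i j) D w z) // -(betaP (_, _) (adj_h i j.+1) D w z) //.
  rewrite -(betaP (_, _) (adj_v i j) D w z) // -(betaP (_, _) (adj_v i.+1 j) D w z) //=.
  (* [z] lies on a surviving curve, so it is blocked for [R (i, j)], whereas [(i, j)] is not. *)
  have zij : z != (i, j).
    rewrite eq_sym; apply: (blocked_neq (proj1 (piP (i, j)))).
    by exists w => //; apply: subsetP wD.
  have := square_crossings zij; rewrite /winding.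
  case: (crosses z _ _); case: (crosses z _ _); case: (crosses z _ _);
    case: (crosses z _ _) => //;
    case: (pi (i, j) z); case: (pi (i.+1, j) z); case: (pi (i, j.+1) z);
    by case: (pi (i.+1, j.+1) z).
have total : \big[addb/false]_(i < N) \big[addb/false]_(j < N)
    (h i j (+) h i j.+1 (+) (v i j (+) v i.+1 j)) = false.
  by rewrite big1 // => i _; rewrite big1.
(* Inner edges belong to two squares, so only the boundary of the box remains. *)
have {total} outer : \big[addb/false]_(i < N) (h i 0 (+) h i N) (+)
    \big[addb/false]_(j < N) (v 0 j (+) v N j) = false.
  rewrite -[RHS]total.
  under [RHS]eq_bigr do rewrite big_split /=.
  rewrite [RHS]big_split /=; congr (_ (+) _).
    by apply: eq_bigr => i _; rewrite (xor_telescope _ (h i)).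
  rewrite exchange_big /=; apply: eq_bigr => j _.
  by rewrite (xor_telescope _ (v^~ j)).
(* The cell [(0, 0)] is on the boundary, so this [D] survives [R0] and determines [beta] on the
   whole boundary. *)
have [D [lD DR]] := big 0 0; have [w [z [wD Swz]]] := wit D lD.
have bd i : i <= N -> [/\ on_boundary (i, 0), on_boundary (i, N),
    on_boundary (0, i) & on_boundary (N, i)].
  by move=> iN; rewrite /on_boundary /= iN leqnn !eqxx !orbT.
have DR0 : D \subset B :\: closed_nbhd e R0.
  rewrite -(R_boundary (0, 0)); first by apply: sub DR; rewrite -setUA subsetUl.
  by case: (bd 0).
have boundary_beta x y : on_boundary x -> on_boundary y -> cell_adj x y ->
    beta (x, y) = pi x z (+) crosses z x y (+) pi y z.
  move=> bx by_ xy; rewrite -(betaP (x, y) xy D w z) //= R_boundary //.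
(* The ray above [z] misses the bottom row and crosses the top row only at [i = z.1]. *)
have hb i : i < N -> h i 0 (+) h i N = (pi (i, 0) z (+) pi (i.+1, 0) z) (+)
    (pi (i, N) z (+) pi (i.+1, N) z) (+) (i == z.1).
  move=> iN; have [b1 b2 _ _] := bd _ iN; have [b3 b4 _ _] := bd _ (ltnW iN).
  rewrite /h !boundary_beta // !crosses_horizontal ltn0 /=.
  have [_ /andP[_ ->]] := S_box Swz; rewrite /=.
  case: (pi (i, 0) z); case: (pi (i.+1, 0) z); case: (pi (i, N) z);
    by case: (pi (i.+1, N) z); case: eqP.
have vb j : j < N -> v 0 j (+) v N j = (pi (0, j) z (+) pi (0, j.+1) z) (+)
    (pi (N, j) z (+) pi (N, j.+1) z).
  move=> jN; have [_ _ b1 b2] := bd _ jN; have [_ _ b3 b4] := bd _ (ltnW jN).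
  rewrite /v !boundary_beta // !crosses_vertical.
  case: (pi (0, j) z); case: (pi (0, j.+1) z); case: (pi (N, j) z);
    by case: (pi (N, j.+1) z).
have [/andP[_ z1N] _] := S_box Swz.
have sum_h : \big[addb/false]_(i < N) (h i 0 (+) h i N) =
    (pi (0, 0) z (+) pi (N, 0) z) (+) (pi (0, N) z (+) pi (N, N) z) (+) true.
  rewrite (eq_bigr _ (fun (i : 'I_N) _ => hb i (ltn_ord i))) big_split /=.
  congr (_ (+) _); last first.
    rewrite (bigD1 (Ordinal z1N)) //= eqxx big1 // => i.
    by rewrite -val_eqE => /negPf.
  rewrite big_split; congr (_ (+) _).
    exact: (xor_telescope N (fun i => pi (i, 0) z)).
  exact: (xor_telescope N (fun i => pi (i, N) z)).
have sum_v : \big[addb/false]_(j < N) (v 0 j (+) v N j) =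
    (pi (0, 0) z (+) pi (0, N) z) (+) (pi (N, 0) z (+) pi (N, N) z).
  rewrite (eq_bigr _ (fun (j : 'I_N) _ => vb j (ltn_ord j))) big_split /=.
  congr (_ (+) _); first exact: (xor_telescope N (fun j => pi (0, j) z)).
  exact: (xor_telescope N (fun j => pi (N, j) z)).
(* Each corner term occurs twice and cancels; the single top crossing remains. *)
move: outer; rewrite sum_h sum_v.
by case: (pi (0, 0) z); case: (pi (N, 0) z); case: (pi (0, N) z); case: (pi (N, N) z).
Qed.

End GridSeparator.

Lemma card_bigcup_leq (T I : finType) (P : pred I) (F : I -> {set T}) :
  #|\bigcup_(i | P i) F i| <= \sum_(i | P i) #|F i|.
Proof.
elim/big_rec2: _ => [|i n A _ IH]; first by rewrite cards0.
by apply: leq_trans (leq_card_setU _ _) _; rewrite leq_add2l.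
Qed.

(** [R] is the union of the four thin sets at a balanced square, each with at most one vertex per
    level. *)
Lemma balanced_separator (V : finType) (e : rel V) (S : V -> cell -> Prop)
    (N : nat) (B : {set V}) :
  (forall v, grid_connected (S v)) ->
  (forall v, exists z, S v z) ->
  (forall v z, S v z -> 0 < z.1 < N /\ 0 < z.2 < N) ->
  (forall u v, e u v -> exists2 z, S u z & S v z) ->
  (forall u v z, S u z -> S v z -> u = v \/ e u v) ->
  set_connected e B -> B != set0 ->
  exists (d : V -> nat) (R : {set V}),
    [/\ R \subset B,
        {in B &, forall u v, e u v -> d v <= (d u).+1},
        forall i, #|[set p in R | d p == i]| <= 4 &
        forall D : {set V}, set_connected e D ->
          D \subset B :\: closed_nbhd e R -> 2 * #|D| <= #|B|].
Proof.
move=> Sconn Sne Sbox Sadj Smeet Bconn /set0Pn[r rB].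
have [d [d_parent d_lip]] := bfs_levels Bconn rB.
have [b rb] := Sne r.
have [R [thinR [i [j bal]]]] := balanced_square Sconn Sne Sbox Sadj Smeet rB rb d_parent.
have level x k : #|[set p in R x | d p == k]| <= 1.
  apply/card_le1_eqP => p q; rewrite !inE => /andP[pR /eqP dp] /andP[qR /eqP dq].
  by have [_ inj] := thinR x; apply: inj; rewrite // dp dq.
exists d; eexists; split; last exact: bal.
- by rewrite !subUset; case: (thinR (i, j)) (thinR (i.+1, j)) (thinR (i, j.+1))
    (thinR (i.+1, j.+1)) => -> _ [-> _] [-> _] [-> _].
- exact: d_lip.
move=> k; rewrite !setIdE !setIUl -!setIdE.
apply: leq_trans (leq_card_setU _ _) _.
rewrite (_ : 4 = 2 + 2) // leq_add //;
  apply: leq_trans (leq_card_setU _ _) _; by rewrite (_ : 2 = 1 + 1) // leq_add.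
Qed.

(** * From separators to spanners *)

Section Spanner.

Variables (V : finType) (e : rel V).
Hypotheses (e_sym : symmetric e) (e_irr : irreflexive e).

Definition joined (H : rel V) (u v : V) : Prop :=
  exists p : seq V, [&& path H u p, last u p == v & size p <= 3].

Definition spans (H : rel V) (B : {set V}) : Prop :=
  {in B &, forall u v, e u v -> joined H u v}.

(** Ordered pairs are counted, so [m] bounds twice the number of edges. *)
Definition spanner_on (B : {set V}) (m : nat) : Prop :=
  exists H : rel V, [/\ symmetric H, subrel H e, spans H B &
    #|[set p : V * V | H p.1 p.2]| <= m].

Lemma joined_sym H u v : symmetric H -> joined H u v -> joined H v u.
Proof.
move=> Hsym [p /and3P[up /eqP <- sp]]; exists (rev (belast u p)).
rewrite size_rev size_belast sp andbT; apply/andP; split.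
  by rewrite rev_path (eq_path (e' := H)) // => x y; rewrite Hsym.
by case: p {up sp} => //= y p; rewrite rev_cons last_rcons.
Qed.

Lemma joined_sub (H H' : rel V) u v : subrel H H' -> joined H u v -> joined H' u v.
Proof. by move=> sub [p /andP[/(sub_path sub) up hp]]; exists p; rewrite up. Qed.

Lemma joined_steps (H : rel V) u s p v :
  H u s -> s = p \/ H s p -> p = v \/ H p v -> joined H u v.
Proof.
move=> us [<-|sp] [<-|pv].
- by exists [:: s]; rewrite /= us eqxx.
- by exists [:: s; v]; rewrite /= us pv eqxx.
- by exists [:: s; p]; rewrite /= us sp eqxx.
- by exists [:: s; p; v]; rewrite /= us sp pv eqxx.
Qed.

(** The constant is [42 = 2 * (1 + 5 * 4)]: per vertex one star edge and one edge for each centre on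
    five levels, four centres a level, in both orientations. *)
Lemma star_spanner (B R : {set V}) (d : V -> nat) :
  R \subset B ->
  {in B &, forall u v, e u v -> d v <= (d u).+1} ->
  (forall i, #|[set p in R | d p == i]| <= 4) ->
  exists H : rel V, [/\ symmetric H, subrel H e,
    {in B & B :&: closed_nbhd e R, forall u v, e u v -> joined H u v} &
    #|[set p : V * V | H p.1 p.2]| <= 42 * #|B|].
Proof.
move=> /subsetP RB lip lev; set X := B :&: closed_nbhd e R.
have /fun_choice[c cP] w : exists p, w \in X -> p \in R /\ (w = p \/ e w p).
  case: (boolP (w \in X)) => [|_]; last by exists w.
  rewrite !inE => /andP[_ /orP[wR|/existsP[p /andP[pR epw]]]].
    by exists w; split=> //; left.
  by exists p; split=> //; right; rewrite e_sym.
(* [s (u, p)] is a neighbour of [u] in the cluster of [p], if there is one. *)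
have /fun_choice[s sP] (t : V * V) : exists w, forall w', w' \in X -> e t.1 w' ->
    c w' = t.2 -> [/\ w \in X, e t.1 w & c w = t.2].
  case: (excluded_middle_informative (exists w, [/\ w \in X, e t.1 w & c w = t.2])).
    by case=> w hw; exists w.
  by move=> no; exists t.1 => w' *; case: no; exists w'.
(* A neighbour of [u] is within one level of [u], and its centre within one level of it. *)
pose near u := [set p in R | (d p <= d u + 2) && (d u <= d p + 2)].
pose A := [set (w, c w) | w in B] :|: \bigcup_(u in B) [set (u, s (u, p)) | p in near u].
have near_card u : #|near u| <= 20.
  apply: (@leq_trans (\sum_(k < 5) #|[set p in R | d p == d u + k - 2]|)).
    apply: leq_trans (card_bigcup_leq predT (fun k : 'I_5 => [set p in R | d p == d u + k - 2])).
    apply: subset_leq_card.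
    apply/subsetP=> p; rewrite inE => /and3P[pR h1 h2].
    have h3 : d p + 2 - d u < 5 by lia.
    by apply/bigcupP; exists (Ordinal h3) => //; rewrite inE pR /=; lia.
  have -> : 20 = \sum_(k < 5) 4 by rewrite sum_nat_const card_ord.
  by apply: leq_sum => k _; apply: lev.
have A_card : #|A| <= 21 * #|B|.
  apply: leq_trans (leq_card_setU _ _) _; rewrite mulSn leq_add ?leq_imset_card //.
  apply: leq_trans (card_bigcup_leq _ _) _; rewrite mulnC -sum_nat_const.
  by apply: leq_sum => u _; apply: leq_trans (leq_imset_card _ _) (near_card u).
(* [A] may contain non-edges, from default values and from centres paired with themselves; [e u v]
   discards them. *)
exists (fun u v => e u v && (((u, v) \in A) || ((v, u) \in A))); split.
- by move=> u v; rewrite e_sym orbC.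
- by move=> u v /andP[].
- have step_c w : w \in X -> w = c w \/ e w (c w) && (((w, c w) \in A) || ((c w, w) \in A)).
    move=> wX; have [_ [<-|ewc]] := cP w wX; [by left|right; rewrite ewc].
    by rewrite !inE imset_f //; case/setIP: wX.
  move=> u v uB vX euv; have [vB _] := setIP vX.
  have [pR vp] := cP v vX; have [sX eus cs] := sP (u, c v) v vX euv erefl.
  have dpv : d (c v) <= (d v).+1 /\ d v <= (d (c v)).+1.
    case: vp => [<-|evp]; first by rewrite leqnSn.
    have cB : c v \in B by apply: RB.
    by split; [apply: lip vB cB evp|apply: lip cB vB _; rewrite e_sym].
  have dvu : d v <= (d u).+1 /\ d u <= (d v).+1
    by split; [apply: lip uB vB euv|apply: lip vB uB _; rewrite e_sym].
  have in_near : (d (c v) <= d u + 2) && (d u <= d (c v) + 2).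
    case: dpv dvu => le1 le2 [le3 le4]; clear -le1 le2 le3 le4; lia.
  apply: (@joined_steps _ u (s (u, c v)) (c v)).
  + rewrite eus /=; apply/orP; left; rewrite inE; apply/orP; right.
    apply/bigcupP; exists u; first exact: uB.
    by apply/imsetP; exists (c v) => //; rewrite inE pR.
  + by have := step_c _ sX; rewrite cs.
  + have [e1|] := step_c v vX; first by left.
    by rewrite e_sym orbC; right.
apply: (@leq_trans (#|A :|: [set (p.2, p.1) | p in A]|)).
  apply: subset_leq_card; apply/subsetP=> -[u v]; rewrite inE /= => /andP[_].
  case/orP=> [uvA|vuA]; first by rewrite inE uvA.
  by rewrite inE; apply/orP; right; apply/imsetP; exists (v, u).
apply: leq_trans (leq_card_setU _ _) _.
by rewrite (_ : 42 = 21 + 21) // mulnDl leq_add // (leq_trans (leq_imset_card _ _)).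
Qed.

Lemma spanner_onU (B B' : {set V}) m m' :
  {in B & B', forall u v, ~~ e u v} ->
  spanner_on B m -> spanner_on B' m' -> spanner_on (B :|: B') (m + m').
Proof.
move=> noe [H [Hsym He Hsp Hm]] [H' [Hsym' He' Hsp' Hm']].
exists (fun u v => H u v || H' u v); split.
- by move=> u v; rewrite Hsym Hsym'.
- by move=> u v /orP[/He|/He'].
- move=> u v /setUP[uB|uB'] /setUP[vB|vB'] euv.
  + by apply: joined_sub (Hsp u v uB vB euv) => x y ->.
  + by have := noe u v uB vB'; rewrite euv.
  + by have := noe v u vB uB'; rewrite e_sym euv.
  + by apply: joined_sub (Hsp' u v uB' vB' euv) => x y ->; rewrite orbT.
apply: leq_trans (leq_add Hm Hm'); apply: leq_trans (leq_card_setU _ _).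
by apply: subset_leq_card; apply/subsetP=> p; rewrite !inE.
Qed.

(** The induction principle fails for some [Q], and no edge leads from the vertices with [Q] to
    those without. *)
Lemma disconnected_split (B : {set V}) : ~ set_connected e B ->
  exists B1 B2 : {set V}, [/\ B = B1 :|: B2, [disjoint B1 & B2], B1 != set0,
    B2 != set0 & {in B1 & B2, forall u v, ~~ e u v}].
Proof.
move=> nconn.
case: (excluded_middle_informative (exists B1 B2 : {set V}, [/\ B = B1 :|: B2,
  [disjoint B1 & B2], B1 != set0, B2 != set0 & {in B1 & B2, forall u v, ~~ e u v}]))
  => // no; case: nconn => Q [u uB Qu] Qstep v vB.
case: (excluded_middle_informative (Q v)) => // nQv; case: no.
pose q x := if excluded_middle_informative (Q x) then true else false.
have qP x : reflect (Q x) (q x).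
  by rewrite /q; case: excluded_middle_informative => ?; constructor.
exists [set x in B | q x], [set x in B | ~~ q x]; split.
- by apply/setP=> x; rewrite !inE -andb_orr orbN andbT.
- rewrite -setI_eq0; apply/eqP/setP=> x; rewrite !inE.
  by case: (q x); rewrite ?andbF.
- by apply/set0Pn; exists u; rewrite inE uB; apply/qP.
- by apply/set0Pn; exists v; rewrite inE vB; apply/qP.
move=> x y; rewrite !inE => /andP[xB /qP Qx] /andP[yB /qP nQy].
by apply/negP => exy; apply: nQy; apply: Qstep Qx.
Qed.

(* Bounding the connected subsets of [B], not [B] itself, lets the recursion treat
   all components of [B] minus a separator at once. *)
Lemma recursive_spanner :
  (forall B : {set V}, set_connected e B -> B != set0 ->
    exists (d : V -> nat) (R : {set V}),
    [/\ R \subset B,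
        {in B &, forall u v, e u v -> d v <= (d u).+1},
        forall i, #|[set p in R | d p == i]| <= 4 &
        forall D : {set V}, set_connected e D ->
          D \subset B :\: closed_nbhd e R -> 2 * #|D| <= #|B|]) ->
  forall k (B : {set V}),
    (forall D : {set V}, set_connected e D -> D \subset B -> #|D| < 2 ^ k) ->
    spanner_on B (42 * k * #|B|).
Proof.
move=> sep; elim=> [|k IHk] B.
  (* Singletons are connected, so the bound [2 ^ 0] leaves [B] empty. *)
  move=> small; exists (fun _ _ => false); split=> //.
    move=> u v uB; have : #|[set u]| < 2 ^ 0.
      apply: small; rewrite ?sub1set // => Q [x]; rewrite inE => /eqP-> Qu _ w.
      by rewrite inE => /eqP->.
    by rewrite cards1.
  by rewrite (_ : [set _ | _] = set0) ?cards0 //; apply/setP=> p; rewrite !inE.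
(* The inner induction on the size of [B] splits a disconnected [B] at the same [k]. *)
have [n] := ubnP #|B|; elim: n B => // n IHn B Bn small.
have [B0|B0] := eqVneq B set0.
  exists (fun _ _ => false); split=> //; first by move=> u v; rewrite B0 inE.
  by rewrite (_ : [set _ | _] = set0) ?cards0 //; apply/setP=> p; rewrite !inE.
case: (excluded_middle_informative (set_connected e B)) => [Bconn|]; last first.
  case/disconnected_split=> B1 [B2 [BE dis B1n B2n noe]].
  have cB : #|B| = #|B1| + #|B2| by rewrite BE cardsU disjoint_setI0 // cards0 subn0.
  rewrite cB mulnDr BE; rewrite -!card_gt0 in B1n B2n.
  apply: spanner_onU => //; apply: IHn; try by lia.
    by move=> D Dc DB1; apply: small Dc _; rewrite BE (subset_trans DB1) ?subsetUl.
  by move=> D Dc DB2; apply: small Dc _; rewrite BE (subset_trans DB2) ?subsetUr.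
have [d [R [RB lip lev bal]]] := sep B Bconn B0.
have [H [Hsym He Hsp Hm]] := star_spanner RB lip lev.
have [|H' [Hsym' He' Hsp' Hm']] := IHk (B :\: closed_nbhd e R).
  move=> D Dconn DB; have := bal D Dconn DB.
  by have := small B Bconn (subxx _); rewrite expnS; lia.
exists (fun u v => H u v || H' u v); split.
- by move=> u v; rewrite Hsym Hsym'.
- by move=> u v /orP[/He|/He'].
- have subH : subrel H (fun u v => H u v || H' u v) by move=> x y ->.
  move=> u v uB vB euv.
  have [vX|vX] := boolP (v \in closed_nbhd e R).
    by apply: joined_sub subH _; apply: Hsp => //; rewrite inE vB.
  have [uX|uX] := boolP (u \in closed_nbhd e R).
    apply: joined_sub subH _; apply: joined_sym => //.
    apply: Hsp; [exact: vB|by rewrite inE uB|by rewrite e_sym].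
  apply: (@joined_sub H'); first by move=> x y ->; rewrite orbT.
  by apply: Hsp'; rewrite // inE ?uX ?vX.
apply: (@leq_trans (42 * #|B| + 42 * k * #|B :\: closed_nbhd e R|)).
  apply: leq_trans (leq_add Hm Hm'); apply: leq_trans (leq_card_setU _ _).
  by apply: subset_leq_card; apply/subsetP=> p; rewrite !inE.
rewrite mulnS mulnDl leq_add2l leq_mul2l; apply/orP; right.
by apply: subset_leq_card; apply: subsetDl.
Qed.

End Spanner.

(** * Rasterizing curves *)

Local Open Scope R_scope.

(** Stated with thresholds, since a maximum then serves finitely many conditions at once. *)
Lemma eventually_all (I : finType) (P : I -> nat -> Prop) :
  (forall i, exists n0, forall n, (n0 <= n)%N -> P i n) ->
  exists n0, forall i n, (n0 <= n)%N -> P i n.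
Proof.
move=> /fun_choice[f fP]; exists (\max_i f i) => i n le_n.
by apply: fP; apply: leq_trans le_n; apply: leq_bigmax.
Qed.

Lemma nat_above (x : R) : exists n0, forall n, (n0 <= n)%N -> x < INR n.
Proof.
have [n0 hn0] := INR_unbounded x; exists n0 => n /leP/le_INR; lra.
Qed.

Lemma continuity_ball (f : R -> R) (x eps : R) : continuity f -> 0 < eps ->
  exists delta : posreal, forall y, Rabs (y - x) < delta -> Rabs (f y - f x) < eps.
Proof.
move=> fc eps0; have [a [a0 ha]] := fc x eps eps0.
exists (mkposreal a a0) => y /= yx.
case: (Req_dec x y) => [->|xy]; first by rewrite Rminus_diag Rabs_R0.
by apply: ha.
Qed.

Definition in01 (s : R) : Prop := 0 <= s <= 1.

Lemma disjoint_curves_apart (x y x' y' : R -> R) :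
  continuity x -> continuity y -> continuity x' -> continuity y' ->
  (forall s t, in01 s -> in01 t -> ~ (x s = x' t /\ y s = y' t)) ->
  exists2 eps, 0 < eps & forall s t, in01 s -> in01 t ->
    eps <= Rabs (x s - x' t) + Rabs (y s - y' t).
Proof.
move=> cx cy cx' cy' disj.
(* One number is both the radius and the lower bound on the distance, so the uniform bound from
   compactness is the required [eps]. *)
have /fun_choice[delta deltaP] (st : R * R) : exists delta : posreal,
    in01 st.1 -> in01 st.2 -> forall s t,
    Rabs (s - st.1) < delta -> Rabs (t - st.2) < delta ->
    delta <= Rabs (x s - x' t) + Rabs (y s - y' t).
  case: st => s0 t0 /=.
  case: (excluded_middle_informative (in01 s0 /\ in01 t0)) => [[s01 t01]|no]; last first.
    by exists (mkposreal _ Rlt_0_1) => s01 t01; case: no.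
  set D := Rabs (x s0 - x' t0) + Rabs (y s0 - y' t0).
  (* Each of four values moves by less than [D / 5], which leaves at least [D / 5]. *)
  have D0 : 0 < D / 5.
    suff : 0 < D by lra.
    have [xx|xx] := Req_dec (x s0 - x' t0) 0.
      have [yy|yy] := Req_dec (y s0 - y' t0) 0.
        by case: (disj s0 t0 s01 t01); split; lra.
      have := Rabs_pos_lt _ yy; have := Rabs_pos (x s0 - x' t0); rewrite /D; lra.
    have := Rabs_pos_lt _ xx; have := Rabs_pos (y s0 - y' t0); rewrite /D; lra.
  have [d1 h1] := continuity_ball s0 cx D0.
  have [d2 h2] := continuity_ball s0 cy D0.
  have [d3 h3] := continuity_ball t0 cx' D0.
  have [d4 h4] := continuity_ball t0 cy' D0.
  pose m := Rmin (D / 5) (Rmin (Rmin d1 d2) (Rmin d3 d4)).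
  have m0 : 0 < m by do !apply: Rmin_pos => //; apply: cond_pos.
  have [mD m1 m2 m3 m4] : [/\ m <= D / 5, m <= d1, m <= d2, m <= d3 & m <= d4].
    rewrite /m; move: (Rmin_l (D / 5) (Rmin (Rmin d1 d2) (Rmin d3 d4)))
      (Rmin_r (D / 5) (Rmin (Rmin d1 d2) (Rmin d3 d4))) (Rmin_l d1 d2) (Rmin_r d1 d2)
      (Rmin_l d3 d4) (Rmin_r d3 d4) (Rmin_l (Rmin d1 d2) (Rmin d3 d4))
      (Rmin_r (Rmin d1 d2) (Rmin d3 d4)) => *; split; lra.
  exists (mkposreal m m0) => _ _ s t /= hs ht.
  have := h1 s ltac:(lra); have := h2 s ltac:(lra).
  have := h3 t ltac:(lra); have := h4 t ltac:(lra).
  move: mD; rewrite /D; clear; split_Rabs; lra.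
have [d dP] := compactness_value_2d 0 1 0 1 (fun s t => delta (s, t)).
exists d; first exact: cond_pos.
move=> s t s01 t01; apply: NNPP => far.
apply: (dP s t s01 t01) => -[u [v [u01 [v01 [su [tv dle]]]]]]; apply: far.
by apply: Rle_trans dle _; apply: (deltaP (u, v)).
Qed.

Lemma uniform_steps (f : R -> R) (eps : R) : continuity f -> 0 < eps ->
  exists n0, forall n, (n0 <= n)%N -> forall s t, in01 s -> in01 t ->
    Rabs (s - t) * INR n <= 1 -> Rabs (f s - f t) <= eps.
Proof.
move=> fc eps0.
have [d dP] := Heine_cor2 (fun x (_ : 0 <= x <= 1) => fc x) (mkposreal eps eps0).
have [n0 n0P] := nat_above (/ d); exists n0 => n le_n s t s01 t01 st.
apply: Rlt_le; apply: dP => //.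
have d0 := cond_pos d; have nd := n0P n le_n.
have n_pos : 0 < INR n by apply: Rlt_trans nd; apply: Rinv_0_lt_compat.
apply: (Rmult_lt_reg_r (INR n)) => //; apply: Rle_lt_trans st _.
by rewrite -(Rinv_r d); [apply: Rmult_lt_compat_l|lra].
Qed.

Lemma bounded_on01 (f : R -> R) : continuity f ->
  exists n0, forall n, (n0 <= n)%N -> forall s, in01 s -> Rabs (f s) <= INR n.
Proof.
move=> fc.
have [a [ha _]] := continuity_ab_maj f 0 1 Rle_0_1 (fun x _ => fc x).
have [b [hb _]] := continuity_ab_min f 0 1 Rle_0_1 (fun x _ => fc x).
have [n0 n0P] := nat_above (Rabs (f a) + Rabs (f b)); exists n0 => n le_n s s01.
have := n0P n le_n; have := ha s s01; have := hb s s01.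
clear; split_Rabs; lra.
Qed.

(** Scaling by [m] separates disjoint curves and shifting by [INR K + 2] makes coordinates at least
    2. Two curves near a common cell are at most 4 apart: 1 per curve and coordinate. *)
Lemma scaled_curves (V : finType) (e : rel V) : is_string_graph e -> irreflexive e ->
  exists (X Y : V -> R -> R) (L M : nat),
  [/\ (0 < M)%N,
      forall v s, in01 s -> 2 <= X v s <= INR L /\ 2 <= Y v s <= INR L,
      forall v s t, in01 s -> in01 t -> Rabs (s - t) * INR M <= 1 ->
        Rabs (X v s - X v t) <= / 2 /\ Rabs (Y v s - Y v t) <= / 2,
      forall u v, e u v -> exists s t,
        [/\ in01 s, in01 t, X u s = X v t & Y u s = Y v t] &
      forall u v, u <> v -> ~ e u v -> forall s t, in01 s -> in01 t ->
        4 < Rabs (X u s - X v t) + Rabs (Y u s - Y v t)].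
Proof.
move=> [g [gc g_adj]] e_irr.
pose x v t := fst (g v t); pose y v t := snd (g v t).
have xc v : continuity (x v) by case: (gc v).
have yc v : continuity (y v) by case: (gc v).
have [m0 m0P] : exists m0, forall (uv : V * V) m, (m0 <= m)%N ->
    uv.1 <> uv.2 -> ~ e uv.1 uv.2 -> forall s t, in01 s -> in01 t ->
    4 < INR m * (Rabs (x uv.1 s - x uv.2 t) + Rabs (y uv.1 s - y uv.2 t)).
  apply: eventually_all => -[u v] /=.
  case: (excluded_middle_informative (u <> v /\ ~ e u v)) => [[uv nuv]|no]; last first.
    by exists 0%N => m _ uv nuv; case: no.
  have [|eps eps0 epsP] := disjoint_curves_apart (xc u) (yc u) (xc v) (yc v).
    move=> s t s01 t01 [hx hy]; apply: nuv; apply/(g_adj u v uv); exists s, t.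
    do 2!split=> //; move: hx hy; rewrite /x /y.
    by case: (g u s) (g v t) => [? ?] [? ?] /= -> ->.
  have [m1 m1P] := nat_above (4 / eps); exists m1 => m le_m _ _ s t s01 t01.
  apply: Rlt_le_trans (Rmult_le_compat_l _ _ _ (pos_INR m) (epsP s t s01 t01)).
  have := Rmult_lt_compat_r eps _ _ eps0 (m1P m le_m).
  by rewrite /Rdiv Rmult_assoc Rinv_l ?Rmult_1_r //; lra.
pose m := m0.+1.
have m_ge1 : 1 <= INR m by rewrite S_INR; have := pos_INR m0; lra.
have [K KP] : exists K, forall v k, (K <= k)%N -> forall s, in01 s ->
    Rabs (x v s) <= INR k /\ Rabs (y v s) <= INR k.
  apply: eventually_all => v.
  have [k1 h1] := bounded_on01 (xc v); have [k2 h2] := bounded_on01 (yc v).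
  by exists (maxn k1 k2) => k; rewrite geq_max => /andP[? ?] s s01; split; auto.
have [M MP] : exists M, forall v n, (M <= n)%N -> forall s t, in01 s -> in01 t ->
    Rabs (s - t) * INR n <= 1 -> Rabs (x v s - x v t) <= / 2 / INR m /\
    Rabs (y v s - y v t) <= / 2 / INR m.
  apply: eventually_all => v.
  have eps0 : 0 < / 2 / INR m by apply: Rdiv_lt_0_compat; lra.
  have [k1 h1] := uniform_steps (xc v) eps0; have [k2 h2] := uniform_steps (yc v) eps0.
  by exists (maxn k1 k2) => k; rewrite geq_max => /andP[? ?] s t *; split;
    [apply: (h1 k) | apply: (h2 k)].
have scale (a c : R) :
    INR m * (INR K + 2 + a) - INR m * (INR K + 2 + c) = INR m * (a - c) by ring.
exists (fun v s => INR m * (INR K + 2 + x v s)), (fun v s => INR m * (INR K + 2 + y v s)).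
exists (m * (K + K + 2))%N, M.+1; split=> //.
- move=> v s s01; have [hx hy] := KP v K (leqnn K) s s01.
  rewrite mult_INR !plus_INR [INR 2]/=.
  have bound a : Rabs a <= INR K ->
      2 <= INR m * (INR K + 2 + a) <= INR m * (INR K + INR K + (1 + 1)).
    move=> /Rabs_le_between ha; split.
      apply: Rle_trans (_ : 1 * 2 <= _); first lra.
      by apply: Rmult_le_compat; lra.
    by apply: Rmult_le_compat_l; lra.
  by split; apply: bound.
- move=> v s t s01 t01 st; have [hx hy] := MP v M.+1 (leqnSn M) s t s01 t01 st.
  have bound a : Rabs a <= / 2 / INR m -> Rabs (INR m * a) <= / 2.
    move=> ha; rewrite Rabs_mult (Rabs_pos_eq (INR m)); last lra.
    apply: Rle_trans (Rmult_le_compat_l (INR m) _ _ ltac:(lra) ha) _.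
    by apply: Req_le; field; lra.
  by rewrite !scale; split; apply: bound.
- move=> u v euv.
  have uv : u <> v by move=> uv; rewrite uv e_irr in euv.
  have [s [t [s01 [t01 gst]]]] := (proj1 (g_adj u v uv)) euv.
  by exists s, t; rewrite /x /y gst.
move=> u v uv nuv s t s01 t01; rewrite !scale !Rabs_mult (Rabs_pos_eq (INR m)); last lra.
rewrite -Rmult_plus_distr_l; exact: (m0P (u, v) m (leqnSn m0) uv nuv s t s01 t01).
Qed.

Lemma nearest_nat (a : R) : 1 <= a -> exists i : nat, Rabs (INR i - a) <= / 2.
Proof.
move=> a1; have [|i hi] := nfloor_ex (a + / 2); first lra.
by exists i; apply: Rabs_le; lra.
Qed.

Lemma near_nat_connected (a : R) (P : nat -> Prop) :
  (forall i, Rabs (INR i - a) <= 1 -> Rabs (INR i.+1 - a) <= 1 -> (P i <-> P i.+1)) ->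
  forall i j, Rabs (INR i - a) <= 1 -> Rabs (INR j - a) <= 1 -> P i -> P j.
Proof.
move=> step.
have up k i : Rabs (INR i - a) <= 1 -> Rabs (INR (i + k)%N - a) <= 1 ->
    (P i <-> P (i + k)%N).
  elim: k => [|k IH] hi hk; first by rewrite addn0.
  rewrite addnS in hk *.
  have hk' : Rabs (INR (i + k)%N - a) <= 1.
    move: hi hk; rewrite S_INR plus_INR; have := pos_INR k.
    by clear; split_Rabs; lra.
  by rewrite (IH hi hk'); apply: step.
move=> i j hi hj; case/orP: (leq_total i j) => /subnKC e; rewrite -e in hi hj *.
  by apply: (proj1 (up _ _ hi hj)).
by apply: (proj2 (up _ _ hj hi)).
Qed.

(** Radius 1 exceeds the rounding error by 1/2, the distance between consecutive samples in each
    coordinate. *)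
Definition near_cell (z : cell) (a c : R) : Prop :=
  Rabs (INR z.1 - a) <= 1 /\ Rabs (INR z.2 - c) <= 1.

Definition curve_cells (x y : R -> R) (z : cell) : Prop :=
  exists2 s, in01 s & near_cell z (x s) (y s).

(** Go from [s0] to [s1] in [M] steps: the cells near one sample form a product of two intervals,
    and consecutive products overlap. *)
Lemma curve_cells_connected (x y : R -> R) (M : nat) : (0 < M)%N ->
  (forall s, in01 s -> 1 <= x s /\ 1 <= y s) ->
  (forall s t, in01 s -> in01 t -> Rabs (s - t) * INR M <= 1 ->
     Rabs (x s - x t) <= / 2 /\ Rabs (y s - y t) <= / 2) ->
  grid_connected (curve_cells x y).
Proof.
move=> M0 ge1 unif Q [z0 [s0 s001 hz0] Qz0] Qadj z [s1 s101 hz].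
have block s w w' : in01 s -> near_cell w (x s) (y s) -> near_cell w' (x s) (y s) ->
    Q w -> Q w'.
  case: w w' => [i j] [i' j'] s01 [/= hi hj] [/= hi' hj'] Qij.
  have Qi'j : Q (i', j).
    apply: (near_nat_connected (a := x s) (P := fun i => Q (i, j))) hi hi' Qij.
    move=> k hk hk1; split; apply: Qadj; rewrite /cell_adj /= ?eqxx ?orbT //;
      by exists s.
  apply: (near_nat_connected (a := y s) (P := fun j => Q (i', j))) hj hj' Qi'j.
  move=> k hk hk1; split; apply: Qadj; rewrite /cell_adj /= ?eqxx ?orbT //;
    by exists s.
have M0' : 0 < INR M by apply: lt_0_INR; apply/ltP.
pose t k := s0 + (s1 - s0) * (INR k / INR M).
have frac k : (k <= M)%N -> 0 <= INR k / INR M <= 1.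
  move=> /leP/le_INR kM; split; first by apply: Rdiv_le_0_compat => //; apply: pos_INR.
  by apply/Rle_div_l => //; lra.
have t01 k : (k <= M)%N -> in01 (t k).
  by move=> /frac; rewrite /in01 /t in s001 s101 *; nra.
have chain k : (k <= M)%N -> forall w, near_cell w (x (t k)) (y (t k)) -> Q w.
  elim: k => [_|k IH kM] w hw.
    apply: block s001 hz0 _ Qz0.
    by move: hw; rewrite /t /Rdiv Rmult_0_l Rmult_0_r Rplus_0_r.
  have k01 := t01 k (ltnW kM); have k101 := t01 _ kM.
  have [|||ux uy] := unif (t k) (t k.+1) => //.
    rewrite /t S_INR (_ : _ - _ = - ((s1 - s0) / INR M)); last by field; lra.
    rewrite Rabs_Ropp /Rdiv Rabs_mult Rabs_inv (Rabs_pos_eq (INR M)); last lra.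
    rewrite Rmult_assoc Rinv_l ?Rmult_1_r; last lra.
    by apply: Rabs_le; rewrite /in01 in s001 s101; lra.
  have [gx gy] := ge1 _ k01.
  have [i hi] := nearest_nat gx; have [j hj] := nearest_nat gy.
  (* The cell rounded from sample [k] is still near sample [k.+1]. *)
  apply: (block _ (i, j) w k101) => //.
    by split=> /=; move: ux uy hi hj; clear; split_Rabs; lra.
  by apply: IH (ltnW kM) _ _; split=> /=; lra.
apply: (chain M (leqnn M)); move: hz; rewrite /t /Rdiv Rinv_r ?Rmult_1_r; last lra.
by rewrite (_ : s0 + (s1 - s0) = s1) //; ring.
Qed.

Lemma grid_representation (V : finType) (e : rel V) :
  is_string_graph e -> irreflexive e ->
  exists (S : V -> cell -> Prop) (N : nat),
  [/\ forall v, grid_connected (S v),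
      forall v, exists z, S v z,
      forall v z, S v z -> (0 < z.1 < N)%N /\ (0 < z.2 < N)%N,
      forall u v, e u v -> exists2 z, S u z & S v z &
      forall u v z, S u z -> S v z -> u = v \/ e u v].
Proof.
move=> str irr; have [X [Y [L [M [M0 range unif meet apart]]]]] := scaled_curves str irr.
have cell_at v s : in01 s -> exists z, near_cell z (X v s) (Y v s).
  move=> s01; have [hx hy] := range v s s01.
  have [|i hi] := nearest_nat (a := X v s); first lra.
  have [|j hj] := nearest_nat (a := Y v s); first lra.
  by exists (i, j); split=> /=; lra.
(* Coordinates lie between 2 and [L], so nearby cells lie between 1 and [L.+1]. *)
exists (fun v => curve_cells (X v) (Y v)), (L.+2); split.
- move=> v; apply: (curve_cells_connected M0); last exact: unif.
  by move=> s s01; have := range v s s01; lra.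
- move=> v; have s01 : in01 0 by rewrite /in01; lra.
  by have [z hz] := cell_at v 0 s01; exists z, 0.
- move=> v [i j] [s s01 [/= hi hj]]; have [hx hy] := range v s s01.
  have inside k a : 2 <= a <= INR L -> Rabs (INR k - a) <= 1 -> (0 < k < L.+2)%N.
    move=> ha hk; have hk1 : 1 <= INR k by move: ha hk; clear; split_Rabs; lra.
    have hk2 : INR k <= INR L.+1.
      by rewrite S_INR; move: ha hk; clear; split_Rabs; lra.
    apply/andP; split; last by rewrite ltnS; apply/leP; apply: INR_le.
    by apply/ltP; apply: INR_lt; rewrite /=; lra.
  by split; [apply: inside hi|apply: inside hj].
- move=> u v /meet[s [t [s01 t01 hx hy]]].
  have [z hz] := cell_at u s s01; exists z; first by exists s.
  by exists t; rewrite // -hx -hy.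
move=> u v z [s s01 [hx hy]] [t t01 [hx' hy']].
case: (eqVneq u v) => [->|/eqP uv]; [by left|right].
apply/idPn => /negP nuv; have := apart u v uv nuv s t s01 t01.
by move: hx hy hx' hy'; clear; split_Rabs; lra.
Qed.

(** * Logarithms and the edge bound *)

Lemma log2_bound (n : nat) : (2 <= n)%N ->
  exists2 k : nat, (n < 2 ^ k)%N & INR k * ln 2 <= 2 * ln (INR n).
Proof.
(* The added 1 is at most the binary logarithm of [n], as [n] is at least 2. *)
move=> n2; exists (trunc_log 2 n).+1; first exact: trunc_log_ltn.
have n0 : 2 <= INR n by apply: (le_INR 2); apply/leP.
have l2 : ln 2 <= ln (INR n) by apply: ln_le; lra.
have : INR (trunc_log 2 n) * ln 2 <= ln (INR n).
  rewrite -ln_pow; last lra.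
  apply: ln_le; first by apply: pow_lt; lra.
  rewrite (_ : 2 = INR 2) // -pow_INR; apply: le_INR; apply/leP.
  have -> : Nat.pow 2 (trunc_log 2 n) = (2 ^ trunc_log 2 n)%N.
    by elim: (trunc_log 2 n) => // k IH; rewrite expnS -IH.
  by apply: trunc_logP => //; apply: leq_trans n2.
by rewrite S_INR; lra.
Qed.

Local Close Scope R_scope.

Theorem theorem2 :
  exists C : R,
    forall (V : finType) (e : rel V),
      symmetric e -> irreflexive e -> is_string_graph e ->
      2 <= #|V| ->
      exists H : rel V,
        hop_spanner 3 e H /\
        (INR (num_edges H) <= C * INR #|V| * (ln (INR #|V|)) ^ 3)%R.
Proof.
have l2 : (0 < ln 2)%R by rewrite -ln_1; apply: ln_increasing; lra.
(* With [l = ln n], the count [42 * k * n] is at most [84 * n * l / ln 2]; the factor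
   [(l / ln 2) ^ 2], at least 1, supplies the cube. *)
exists (84 / ln 2 ^ 3)%R => V e e_sym e_irr str n2.
have [S [N [Sconn Sne Sbox Sadj Smeet]]] := grid_representation str e_irr.
have [k nk kl] := log2_bound n2.
have [|H [Hsym He Hsp Hm]] := @recursive_spanner V e e_sym
  (fun B => balanced_separator Sconn Sne Sbox Sadj Smeet (B := B)) k [set: V].
  by move=> D _ _; apply: leq_ltn_trans nk; apply: max_card.
exists H; split.
  by split=> //; split=> // u v euv; apply: Hsp; rewrite ?inE.
have Hm' : num_edges H <= 42 * k * #|V|.
  by apply: leq_trans (leq_div _ _) _; rewrite -cardsT.
apply: Rle_trans (le_INR _ _ (leP Hm')) _.
rewrite !mult_INR (_ : INR 42 = 42%R); last by rewrite INR_IZR_INZ.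
have n0 : (0 < INR #|V|)%R by apply: lt_0_INR; apply/ltP; apply: ltnW.
have ln2n : (ln 2 <= ln (INR #|V|))%R.
  by apply: ln_le; [lra|apply: (le_INR 2); apply/leP].
set l := ln (INR #|V|) in kl ln2n *.
have kl' : (INR k <= 2 * l / ln 2)%R by apply/Rle_div_r.
have l2l : (ln 2 ^ 2 <= l ^ 2)%R by apply: pow_incr; lra.
apply: (@Rle_trans _ (42 * (2 * l / ln 2) * INR #|V|)%R).
  by apply: Rmult_le_compat_r; [lra|apply: Rmult_le_compat_l; lra].
rewrite (_ : 84 / _ * _ * _ = (42 * (2 * l / ln 2) * INR #|V|) * (l ^ 2 / ln 2 ^ 2))%R;
  last by field; lra.
rewrite -{1}[X in (X <= _)%R]Rmult_1_r; apply: Rmult_le_compat_l.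
  apply: Rmult_le_pos; last lra.
  by apply: Rmult_le_pos; [lra|apply: Rdiv_le_0_compat; lra].
by apply/Rle_div_r; [apply: pow_lt|rewrite Rmult_1_l].
Qed.
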